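(* Let $k \geq 3$, $g \geq 3$ and $0 < \varepsilon \leq \frac{k-1}{2}$ be integers, where $g$ is odd. Then for every positive integer $n$ there does not exist a $\mathrm{vgr}\left(n,k,g,\frac{k(k-1)^{\lfloor g/2\rfloor}}{2}-\varepsilon\right)$-graph; that is, there is no $k$-regular graph of girth $g$ on $n$ vertices in which every vertex is contained in exactly $\frac{k(k-1)^{\lfloor g/2\rfloor}}{2}-\varepsilon$ cycles of length $g$.
   Context: Graphs are finite, simple and undirected. The girth of a graph is the length of its shortest cycle. Cycles are counted as subgraphs (i.e. without a choice of starting vertex or orientation). For integers $n,k,g,\lambda$, a $\mathrm{vgr}(n,k,g,\lambda)$-graph (vertex-girth-regular graph) is a $k$-regular graph of girth $g$ on $n$ vertices such that each vertex is contained in exactly $\lambda$ cycles of length $g$. *)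

(* Defs.v *)
From mathcomp Require Import all_boot.

Set Implicit Arguments.
Unset Strict Implicit.
Unset Printing Implicit Defensive.

Record sgraph := SGraph {
  vertex :> finType;
  adj : rel vertex;
  adj_sym : symmetric adj;
  adj_irrefl : irreflexive adj
}.

Definition degree (G : sgraph) (x : G) : nat := #|[set y : G | adj x y]|.

Definition regular (G : sgraph) (k : nat) : Prop :=
  forall x : G, degree x = k.

Definition cycle_edges (T : finType) (p : seq T) : {set {set T}} :=
  [set [set x; next p x] | x in p].

(* A cycle is identified with its edge set, so that the 2l closed walks which
   differ only by starting vertex and orientation give one and the same cycle.
   Since [ucycleb] also accepts sequences of length 0 and 2, the bound on l is
   needed. *)
Definition cycles (G : sgraph) (l : nat) : {set {set {set G}}} :=
  [set cycle_edges t | t : l.-tuple G & (2 < l) && ucycleb (@adj G) t].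

(* An acyclic graph satisfies this for no g. *)
Definition has_girth (G : sgraph) (g : nat) : Prop :=
  cycles G g != set0 /\ forall l : nat, cycles G l != set0 -> g <= l.

Definition cycles_through (G : sgraph) (l : nat) (x : G) : {set {set {set G}}} :=
  [set C in cycles G l | x \in cover C].

Definition vgr (n k g lambda : nat) (G : sgraph) : Prop :=
  [/\ #|G| = n, regular G k, has_girth G g
    & forall x : G, #|cycles_through g x| = lambda].

(* Main.v *)
Require Import Defs.
From mathcomp Require Import all_boot all_order all_algebra.
Import Order.TTheory GRing.Theory Num.Theory.
Local Open Scope ring_scope.

(** Write [g = 2d + 1] and let [B(x)] be the ball of radius [d] around [x].
Below the girth, nonbacktracking walks are determined by their endpoints.  Hence,
for every edge [xy], the nonbacktracking walks that start with [x, y] and take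
[d] further steps have [(k-1)^d] distinct endpoints.  Such an endpoint either
lies in [B(x)], and then the walk closes up into a unique [g]-cycle through the
arc [xy], or it lies in [B(y) \ B(x)], and every vertex of [B(y) \ B(x)] arises
in this way.  So, with [a(x,y) = |B(y) \ B(x)|],

  [#(g-cycles through xy) + a(x,y) = (k-1)^d]      ([card_ballD]).

Two consequences carry the proof: [a] is symmetric, and summing over the [k]
neighbours of [x], each [g]-cycle through [x] being seen by the two arcs with
which it leaves [x],
[2 lambda + sum_y a(x,y) = k (k-1)^d].  The hypothesis on [lambda] therefore
says that [sum_y a(x,y) = 2 eps] at every vertex [x], where [0 < 2 eps <= k-1].

This is impossible ([regular_leq_excess]).  Call a neighbour [u] of [x] a twin
of [x] if [a(x,u) = 0], that is, if [B(u) = B(x)], and choose [v] with the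
largest number [t] of twins.  As the sum at [v] is positive, some [w] lies at
distance [d+1] from [v]; let [z] be the neighbour of [w] on a geodesic from [v].
Then [z] is in [B(v)] and [w] is not, and the same holds for the balls around
the twins of [v], so that [v] and its [t] twins all lie in [B(z) \ B(w)], whence
[a(z,w) >= t + 1].  Every other neighbour of [z] that is not a twin of [z]
contributes at least [1], and [z] has at most [t] twins, so the sum at [z] is at
least [(t + 1) + (k - 1 - t) = k]. *)

(** * Cycles as edge sets *)

Section CycleEdges.
Set Implicit Arguments.
Unset Strict Implicit.
Local Open Scope nat_scope.
Variable T : finType.
Implicit Types (p q : seq T) (x y : T).

Lemma cycle_edges_rot n p : uniq p -> cycle_edges (rot n p) = cycle_edges p.
Proof.
move=> Up; apply/setP=> e; apply/imsetP/imsetP=> -[x xp ->]; exists x => //.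
- by rewrite mem_rot in xp.
- by rewrite next_rot.
- by rewrite mem_rot.
- by rewrite next_rot.
Qed.

Lemma cycle_edges_rev p : uniq p -> cycle_edges (rev p) = cycle_edges p.
Proof.
move=> Up; apply/setP=> e; apply/imsetP/imsetP=> -[x xp ->].
  exists (prev p x); rewrite ?mem_prev -?(mem_rev p) //.
  by rewrite next_prev // next_rev // setUC.
exists (next p x); first by rewrite mem_rev mem_next.
by rewrite next_rev // prev_next // setUC.
Qed.

Lemma cycle_edges_rev_tail x p :
  uniq (x :: p) -> cycle_edges (x :: rev p) = cycle_edges (x :: p).
Proof.
move=> Up; have -> : x :: rev p = rotr 1 (rev (x :: p)).
  by rewrite rev_cons rotr1_rcons.
by rewrite cycle_edges_rot ?rev_uniq // cycle_edges_rev.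
Qed.

Lemma mem_cycle_edges p x y : [set x; y] \in cycle_edges p ->
  (y == next p x) || (x == next p y).
Proof.
case/imsetP=> z _ /setP eE.
have := eE x; have := eE y; have := eE z; have := eE (next p z).
rewrite !inE !eqxx ?orbT /= => nE zE yE xE.
move: (esym xE) (esym yE) => /orP[] /eqP xz /orP[] /eqP yz.
- by move: nE; rewrite xz yz orbb => /eqP->; rewrite eqxx.
- by rewrite xz yz eqxx.
- by rewrite xz yz eqxx orbT.
- by move: zE; rewrite xz yz orbb => /eqP {1}->; rewrite eqxx.
Qed.

Lemma cycle_edges_next p x : x \in p -> [set x; next p x] \in cycle_edges p.
Proof. by move=> xp; apply/imsetP; exists x. Qed.

Lemma cover_cycle_edges p : cover (cycle_edges p) =i p.
Proof.
move=> x; apply/bigcupP/idP=> [[e /imsetP[y yp ->]]|xp].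
  by rewrite !inE => /orP[]/eqP->; rewrite ?mem_next.
by exists [set x; next p x]; rewrite ?cycle_edges_next // !inE eqxx.
Qed.

Lemma next_nth_uniq x p i : uniq (x :: p) -> i <= size p ->
  next (x :: p) (nth x (x :: p) i) = nth x (x :: p) i.+1.
Proof.
by move=> Up lei; rewrite next_nth mem_nth // index_uniq.
Qed.

(** Once the first step agrees, the two sequences agree everywhere: the vertex
after [u] in [p] is one of the two neighbours of [u] in [q], and the neighbour
from which [u] was reached is excluded because [p] has no repetition. *)
Lemma cycle_edges_inj_next x p q : uniq (x :: p) -> uniq (x :: q) ->
  size p = size q -> cycle_edges (x :: p) = cycle_edges (x :: q) ->
  next (x :: p) x = next (x :: q) x -> p = q.
Proof.
move=> Up Uq szE eE nE.
suff H i : i < size p -> nth x (x :: p) i = nth x (x :: q) i /\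
                         nth x (x :: p) i.+1 = nth x (x :: q) i.+1.
  by apply: (@eq_from_nth _ x) => // i /H[].
elim: i => [|i IH] lti.
  by split=> //; rewrite -!next_nth_uniq -?szE.
have [Hi Hi1] := IH (ltnW lti); split=> //.
have := @cycle_edges_next (x :: p) (nth x (x :: p) i.+1).
rewrite mem_nth ?(ltn_trans lti) // => /(_ isT).
rewrite next_nth_uniq // 1?ltnW // eE.
case/mem_cycle_edges/orP=> /eqP E.
  by rewrite E Hi1 next_nth_uniq // -szE ltnW.
have: prev (x :: q) (nth x (x :: q) i.+1) = nth x (x :: q) i.
  by rewrite -next_nth_uniq ?prev_next // -szE ltnW // ltnW.
rewrite -Hi1 E prev_next // -Hi => /eqP.
by rewrite nth_uniq ?gtn_eqF //= ltnS ltnW // ltnW.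
Qed.

(** A rooted cycle is recovered from its edge set up to orientation; this gives
the factor [2] between rooted cycles and cycles. *)
Lemma cycle_edges_inj x p q : uniq (x :: p) -> uniq (x :: q) ->
  size p = size q -> cycle_edges (x :: p) = cycle_edges (x :: q) ->
  p = q \/ p = rev q.
Proof.
move=> Up Uq szE eE.
have := cycle_edges_next (mem_head x p); rewrite eE => /mem_cycle_edges.
case/orP=> /eqP E; [left|right]; apply: (@cycle_edges_inj_next x) => //.
- by rewrite /= rev_uniq mem_rev.
- by rewrite size_rev.
- by rewrite cycle_edges_rev_tail.
have -> : x :: rev q = rotr 1 (rev (x :: q)) by rewrite rev_cons rotr1_rcons.
rewrite next_rotr ?rev_uniq // next_rev //.
by have := congr1 (prev (x :: q)) E; rewrite (prev_next Uq).
Qed.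
End CycleEdges.

(** * Rooted cycles *)

Section Walks.
Set Implicit Arguments.
Unset Strict Implicit.
Local Open Scope nat_scope.
Variable G : sgraph.
Implicit Types (x y z w : G) (p q s : seq G).

Definition rooted_cycles g x : {set g.-tuple G} :=
  [set t : g.-tuple G | ucycleb (@adj G) t && (ohead t == Some x)].

Definition arc_cycles g x y : {set g.-tuple G} :=
  [set t : g.-tuple G | ucycleb (@adj G) t && prefix [:: x; y] t].

Lemma ucycleb_rot n p : ucycleb (@adj G) (rot n p) = ucycleb (@adj G) p.
Proof. by rewrite /ucycleb rot_cycle rot_uniq. Qed.

Lemma ucycleb_rev p : ucycleb (@adj G) (rev p) = ucycleb (@adj G) p.
Proof.
rewrite /ucycleb rev_cycle rev_uniq; congr (_ && _).
by apply: eq_cycle => x y; rewrite adj_sym.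
Qed.

Lemma ucycleb_rev_tail x p :
  ucycleb (@adj G) (x :: rev p) = ucycleb (@adj G) (x :: p).
Proof. by rewrite -ucycleb_rev rev_cons revK -rot1_cons ucycleb_rot. Qed.

Lemma card_rooted_cycles g x :
  2 < g -> #|rooted_cycles g x| = (#|cycles_through g x|).*2.
Proof.
move=> g2; rewrite -sum1_card.
rewrite (partition_big (fun t : g.-tuple G => cycle_edges t)
          [in cycles_through g x]) /=; last first.
  move=> t; rewrite !inE => /andP[ut /eqP tx]; rewrite cover_cycle_edges.
  rewrite imset_f ?inE ?g2 //=.
  by case: (tval t) tx => //= y s [->]; rewrite mem_head.
rewrite (eq_bigr (fun=> 2)) ?sum_nat_const ?muln2 // => C.
rewrite inE => /andP[/imsetP[t]]; rewrite inE g2 /= => ut ->{C}.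
rewrite cover_cycle_edges => /rot_to[i p pE].
have up : ucycleb (@adj G) (x :: p) by rewrite -pE ucycleb_rot.
have [_ Up] := andP up.
have sz1 : size (x :: p) == g by rewrite -pE size_rot size_tuple.
have sz2 : size (x :: rev p) == g by rewrite /= size_rev.
have eE : cycle_edges t = cycle_edges (x :: p).
  by rewrite -pE cycle_edges_rot //; case/andP: ut.
have n12 : Tuple sz1 != Tuple sz2.
  apply: contraTneq g2 => /(congr1 val)[]; rewrite -(eqP sz1) /=.
  move: Up; case: {up pE sz1 sz2 eE} p => [|a p] //=.
  rewrite rev_cons; case/lastP: p => [|p b] //=.
  rewrite rev_rcons => /and3P[_ + _] [ab _].
  by rewrite ab mem_rcons mem_head.
have -> : 2 = #|[set Tuple sz1; Tuple sz2]| by rewrite cards2 n12.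
rewrite -sum1_card; apply: eq_bigl => u; rewrite !inE eE.
apply/andP/orP => [[/andP[uu /eqP ux] /eqP ueE]|].
  have uv : tval u = x :: behead u by case: (tval u) ux => //= y s [->].
  have Uu : uniq (x :: behead u) by rewrite -uv; case/andP: uu.
  have szu : size (behead u) = size p.
    by rewrite size_behead size_tuple -(eqP sz1).
  have [] := cycle_edges_inj Uu Up szu; first by rewrite -uv.
    by move=> E; left; apply/eqP/val_inj; rewrite /= uv E.
  by move=> E; right; apply/eqP/val_inj; rewrite /= uv E.
case=> /eqP-> /=; first by rewrite up !eqxx.
by rewrite cycle_edges_rev_tail // ucycleb_rev_tail up !eqxx.
Qed.

Lemma sum_arc_cycles g x : 1 < g ->
  \sum_(y | adj x y) #|arc_cycles g x y| = #|rooted_cycles g x|.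
Proof.
move=> g1; rewrite -[RHS]sum1_card.
have E (t : g.-tuple G) : t \in rooted_cycles g x ->
    exists2 s, tval t = [:: x, nth x t 1 & s] & adj x (nth x t 1).
  rewrite inE => /andP[/andP[ct _] /eqP tx].
  have := size_tuple t; case: (tval t) tx ct => [|a [|b s]] //=.
  - by move=> _ _ h; rewrite -h in g1.
  - by move=> [->] /andP[ab _] _; exists s.
rewrite (partition_big (fun t : g.-tuple G => nth x t 1) (adj x)) /=; last first.
  by move=> t /E[].
apply: eq_bigr => y axy; rewrite -sum1_card; apply: eq_bigl => t.
apply/idP/andP=> [|[tr /eqP ty]].
  by rewrite !inE => /andP[-> /prefixP[s ->]] /=; rewrite !eqxx.
have [s ts _] := E _ tr; move: tr; rewrite !inE => /andP[-> _] /=.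
by rewrite ts ty -[X in prefix X _]/([:: x; y]) /= !eqxx prefix0s.
Qed.

(** Reversing a cycle and rotating it by two turns [x, y, ...] into
[y, x, ...]. *)
Lemma card_arc_cyclesC g x y : #|arc_cycles g x y| = #|arc_cycles g y x|.
Proof.
wlog suff: x y / #|arc_cycles g x y| <= #|arc_cycles g y x|.
  by move=> H; apply/eqP; rewrite eqn_leq !H.
have inj_f : injective (fun t : g.-tuple G => [tuple of rev (rot 2 t)]).
  by move=> t u /(congr1 val)/(can_inj revK)/rot_inj; apply: val_inj.
rewrite -(card_imset _ inj_f); apply/subset_leq_card/subsetP=> _ /imsetP[t + ->].
rewrite !inE /= ucycleb_rev ucycleb_rot => /andP[-> /prefixP[s ->]] /=.
by rewrite /rot /= drop0 take0 rev_cat /= !eqxx prefix0s.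
Qed.

(** * Nonbacktracking walks *)

Fixpoint nonbacktracking s :=
  if s is x :: s1 then
    (if s1 is _ :: s2 then ohead s2 != Some x else true) && nonbacktracking s1
  else true.

Definition nbwalk s := sorted (@adj G) s && nonbacktracking s.

Lemma nbwalk_cons2 x y s :
  nbwalk [:: x, y & s] = [&& adj x y, ohead s != Some x & nbwalk (y :: s)].
Proof.
by rewrite /nbwalk /=; case: (adj x y); case: (path _ _ _); case: (ohead s != _).
Qed.

Lemma nbwalk_behead x s : nbwalk (x :: s) -> nbwalk s.
Proof. by case: s => // y s; rewrite nbwalk_cons2 => /and3P[]. Qed.

Lemma nbwalk_rcons s z : nbwalk (rcons s z) -> nbwalk s.
Proof.
elim: s => [|x [|y s] IH] //=; rewrite !nbwalk_cons2 => /and3P[-> + /IH->].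
by rewrite andbT; case: s {IH}.
Qed.

Lemma nbwalk_uniq_path x s : path (@adj G) x s -> uniq (x :: s) -> nbwalk (x :: s).
Proof.
elim: s x => [|y s IH] x // /andP[xy ys] /andP[xs us].
rewrite nbwalk_cons2 xy IH //= andbT; case: s xs {IH ys us} => //= z s.
by rewrite !inE; apply: contra => /eqP[->]; rewrite eqxx orbT.
Qed.

(** Two nonbacktracking walks with a common origin [x] and different first steps
join into one nonbacktracking walk.  With [catrev] the induction moves the origin
along [p], and its hypothesis is exactly the absence of backtracking in [p]. *)
Lemma nbwalk_catrev x p q : nbwalk (x :: p) -> nbwalk (x :: q) ->
  (p == [::]) || (ohead p != ohead q) -> nbwalk (catrev p (x :: q)).
Proof.
elim: p x q => [|y p IH] x q // + xq /= neq.
rewrite nbwalk_cons2 => /and3P[xy px yp]; apply: IH => //=.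
  by rewrite nbwalk_cons2 adj_sym xy eq_sym neq.
by rewrite px orbT.
Qed.

(** The rightmost vertex that occurs again later closes up a cycle with its next
occurrence; its length is at least [3] because the walk does not backtrack. *)
Lemma nbwalk_cycle s : nbwalk s -> ~~ uniq s ->
  exists2 l, cycles G l != set0 & l < size s.
Proof.
elim: s => [|x s IH] // xs; have us := nbwalk_behead xs.
case: (boolP (uniq s)) => [Us | nUs _]; last first.
  by have [l lc ls] := IH us nUs; exists l => //; apply: ltnW.
rewrite /= Us andbT negbK => xin.
case/splitPr: xin xs Us {IH us} => p1 p2 xs Us.
exists (size (x :: p1)); last by rewrite /= size_cat /= addnS !ltnS leq_addr.
apply/set0Pn; exists (cycle_edges (in_tuple (x :: p1))).
apply/imsetP; exists (in_tuple (x :: p1)) => //; rewrite inE /=.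
case/andP: xs => /=; rewrite cat_path /= => /and3P[xp1 p1x _] nb.
move: Us; rewrite /ucycleb /= rcons_path xp1 p1x /= cat_uniq /=.
case/and3P=> -> /norP[-> _] _; rewrite !andbT.
case: p1 p1x xp1 nb => [|a [|b p1]] //=; first by rewrite adj_irrefl.
by rewrite eqxx.
Qed.

(** A cycle is cut at its initial vertex [x] and at [last y s1]. *)
Lemma ucycleb_nbwalks x y s1 s2 : ucycleb (@adj G) [:: x, y & s1 ++ s2] ->
  nbwalk [:: x, y & s1] /\ nbwalk (last y s1 :: rcons s2 x).
Proof.
case/andP=> /=; rewrite rcons_cat cat_path => /and3P[xy ys1 s2x] U.
have : uniq ([:: x, y & s1] ++ s2) by [].
rewrite cat_uniq => /and3P[U1 /hasPn dis U2]; split.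
  by apply: nbwalk_uniq_path => //=; rewrite xy.
apply: nbwalk_uniq_path => //=; rewrite mem_rcons rcons_uniq U2 andbT inE negb_or.
have xl : x != last y s1.
  by case/andP: U1 => + _; apply: contraNneq => ->; apply: mem_last.
rewrite eq_sym xl /=; apply/andP; split; apply/negP=> /dis/negP[].
  by rewrite inE mem_last orbT.
exact: mem_head.
Qed.

(** * Balls and branches *)

Definition ball d x : {set G} :=
  [set w | [exists p : d.-bseq G, path (@adj G) x p && (last x p == w)]].

Definition branch d x y : {set G} :=
  [set w | [exists p : d.-tuple G, nbwalk [:: x, y & p] && (last y p == w)]].

Lemma ballP d x w :
  reflect (exists p, [/\ path (@adj G) x p, last x p = w & size p <= d])
          (w \in ball d x).
Proof.
rewrite inE; apply: (iffP existsP) => [[p /andP[xp /eqP pw]]|[p [xp pw sp]]].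
  by exists p; split=> //; apply: size_bseq.
by exists (Bseq sp); rewrite xp pw eqxx.
Qed.

Lemma branchP d x y w :
  reflect (exists p, [/\ nbwalk [:: x, y & p], last y p = w & size p = d])
          (w \in branch d x y).
Proof.
rewrite inE; apply: (iffP existsP) => [[p /andP[xp /eqP pw]]|[p [xp pw /eqP sp]]].
  by exists p; split=> //; apply: size_tuple.
by exists (Tuple sp); rewrite xp pw eqxx.
Qed.

Lemma ball_nbwalk d x w : w \in ball d x ->
  exists p, [/\ nbwalk (x :: p), last x p = w & size p <= d].
Proof.
case/ballP=> p [xp <- sp]; case/shortenP: xp => q xq Uq sq.
exists q; split=> //; first exact: nbwalk_uniq_path.
by apply: leq_trans sp; apply: uniq_leq_size => //; case/andP: Uq.
Qed.

Lemma ballC d x w : (w \in ball d x) = (x \in ball d w).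
Proof.
wlog suff: x w / w \in ball d x -> x \in ball d w.
  by move=> H; apply/idP/idP; apply: H.
case/ballP=> p [xp <- sp]; apply/ballP; exists (rev (belast x p)).
split; last by rewrite size_rev size_belast.
  by rewrite rev_path; under eq_path do rewrite adj_sym.
by case: p {xp sp} => //= y p; rewrite rev_cons last_rcons.
Qed.

(** A shortest walk from [y] to a vertex [w] outside [ball d x] has length exactly
[d] and does not step back to [x]: otherwise [w] would be within distance [d]
of [x]. *)
Lemma ballD_branch d x y : adj x y ->
  ball d y :\: ball d x = branch d x y :\: ball d x.
Proof.
move=> xy; apply/setP=> w; rewrite !in_setD.
case: (boolP (w \in ball d x)) => //= nw.
apply/idP/idP=> [/ball_nbwalk[p [yp pw sp]]|/branchP[p [xyp pw sp]]]; last first.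
  apply/ballP; exists p; split=> //; last by rewrite sp.
  by move: xyp; rewrite nbwalk_cons2 => /and3P[_ _ /andP[]].
apply/branchP; exists p; split=> //.
  rewrite nbwalk_cons2 xy yp andbT /=; case: p yp pw sp => //= z p.
  case/andP=> /= /andP[_ zp] _ pw sp; apply: contra nw => /eqP[<-].
  by apply/ballP; exists p; split=> //; apply: ltnW.
apply/eqP; rewrite eqn_leq sp leqNgt; apply: contra nw => sp'.
apply/ballP; exists (y :: p); rewrite /= xy; split=> //.
by case/andP: yp.
Qed.

(** * Consequences of the girth *)

Section Girth.
Variable g : nat.
Hypothesis girth_ge : forall l, cycles G l != set0 -> g <= l.

Lemma nbwalk_uniq s : nbwalk s -> size s <= g -> uniq s.
Proof.
move=> ws sg; apply: contraTT isT => nU; have [l lc ls] := nbwalk_cycle ws nU.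
by have := leq_trans (leq_trans ls sg) (girth_ge lc); rewrite ltnn.
Qed.

(** Two walks that leave [x] differently and meet again form a closed
nonbacktracking walk, which contains a cycle. *)
Lemma nbwalk_catrev_closed x p q : nbwalk (x :: p) -> nbwalk (x :: q) ->
  p != [::] -> ohead p != ohead q -> last x p = last x q ->
  g <= size p + size q.
Proof.
move=> xp xq p0 hpq lpq; rewrite leqNgt; apply/negP=> lt_g.
have := nbwalk_catrev xp xq; rewrite hpq orbT => /(_ isT)/nbwalk_uniq.
rewrite catrevE size_cat size_rev /= addnS => /(_ lt_g).
rewrite cat_uniq has_sym => /and3P[_ /hasPn/(_ (last x p)) + _].
rewrite mem_rev; case: p p0 {xp hpq lt_g} lpq => //= y p _ lpq.
by rewrite mem_last lpq mem_last => /(_ isT).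
Qed.

(** The vertex [w] is listed once in the conclusion, as the end of [p].  If the
two walks met anywhere else, the closed walk would contain a cycle of length
less than [g]. *)
Lemma nbwalk_ucycleb x p q w : nbwalk (x :: p) -> nbwalk (x :: rcons q w) ->
  last x p = w -> ohead p != ohead (rcons q w) -> size p + size q < g ->
  ucycleb (@adj G) (x :: p ++ rev q).
Proof.
move=> xp xq pw hpq szpq; apply/andP; split.
  rewrite /= rcons_cat -rev_cons cat_path pw.
  case/andP: (xp) => /= -> _; case/andP: (xq) => /= xqw _.
  have:= xqw; rewrite (eq_path (fun a b => adj_sym a b)) -rev_path.
  by rewrite last_rcons belast_rcons.
have hpq' : (p == [::]) || (ohead p != ohead q).
  by case: q hpq {xq szpq} => [|a q] /= h; rewrite ?h ?orbT //; case: (p).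
have := nbwalk_uniq (nbwalk_catrev xp (@nbwalk_rcons (x :: q) w xq) hpq').
rewrite catrevE size_cat size_rev /= addnS => /(_ szpq) U.
rewrite -[_ && _]/(uniq ((x :: p) ++ rev q)) uniq_catC.
by rewrite -cat_rcons -rev_cons -rev_uniq rev_cat revK.
Qed.

(** After removing the common initial part, the two walks would form a closed
nonbacktracking walk shorter than the girth. *)
Lemma nbwalk_inj x p q : nbwalk (x :: p) -> nbwalk (x :: q) ->
  last x p = last x q -> size p + size q < g -> p = q.
Proof.
elim: p x q => [|y p IH] x [|z q] // xp xq lpq lt_g.
- have := nbwalk_catrev_closed xq xp isT isT (esym lpq).
  by rewrite addnC leqNgt lt_g.
- by have := nbwalk_catrev_closed xp xq isT isT lpq; rewrite leqNgt lt_g.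
have [eq_yz|neq_yz] := eqVneq y z.
  rewrite -eq_yz; congr cons; apply: (IH y) => //.
  - exact: nbwalk_behead xp.
  - by rewrite eq_yz; apply: nbwalk_behead xq.
  - by rewrite [last y q](_ : _ = last x (z :: q)) // eq_yz.
  - by apply: leq_trans lt_g; rewrite /= addSn addnS ltnS leqW ?leqnSn.
have: ohead (y :: p) != ohead (z :: q) by apply: contra_neq neq_yz => -[].
by move/(nbwalk_catrev_closed xp xq isT)/(_ lpq); rewrite leqNgt lt_g.
Qed.

(** The branches of length [d] behind the different neighbours [z] of [y] are
disjoint, since a common endpoint would be reached from [y] by two distinct
walks of total length [2d + 2]. *)
Lemma card_branch k d x y : regular G k -> adj x y -> d.*2 < g ->
  #|branch d x y| = k.-1 ^ d.
Proof.
move=> reg; elim: d x y => [|d IH] x y xy dg.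
  rewrite expn0 -(cards1 y); congr #|pred_of_set _|; apply/setP=> w; rewrite inE.
  apply/branchP/eqP=> [[p [_ <- /size0nil->]] // | ->].
  by exists [::]; rewrite /nbwalk /= xy.
pose F z := if adj y z && (z != x) then branch d y z else set0.
have -> : branch d.+1 x y = \bigcup_z F z.
  apply/setP=> w; apply/branchP/bigcupP=> [[[|z p] [xyp pw [sp]]] //|[z _]].
    move: xyp; rewrite nbwalk_cons2 => /and3P[_ zx yzp].
    exists z => //; rewrite /F (_ : adj y z && _).
      by apply/branchP; exists p.
    by move: yzp zx; rewrite nbwalk_cons2 => /andP[-> _]; apply: contraNneq => ->.
  rewrite /F; case: ifP => [/andP[yz zx]|_]; last by rewrite inE.
  case/branchP=> p [yzp pw sp].
  exists (z :: p); split=> //=; last by rewrite sp.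
  by rewrite nbwalk_cons2 xy yzp andbT /=; apply: contraNneq zx => -[->].
rewrite -sum1_card partition_disjoint_bigcup /=; last first.
  move=> z1 z2 n12; rewrite /F.
  case: ifP => // _; last by rewrite disjoints_subset sub0set.
  case: ifP => // _; last by rewrite disjoint_sym disjoints_subset sub0set.
  rewrite -setI_eq0; apply/set0Pn=> -[w /setIP[]].
  move=> /branchP[p [yp pw sp]] /branchP[q [yq qw sq]].
  have := @nbwalk_inj y (z1 :: p) (z2 :: q) yp yq.
  rewrite /= pw qw sp sq => /(_ erefl); rewrite addnn dg => /(_ isT)[E _].
  by rewrite E eqxx in n12.
rewrite (bigID (fun z => adj y z && (z != x))) /=.
rewrite [X in _ + X]big1 ?addn0; last first.
  by move=> z /negbTE nz; rewrite /F nz big_set0.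
rewrite (eq_bigr (fun=> k.-1 ^ d)) => [|z yzx]; last first.
  rewrite /F yzx sum1_card; case/andP: yzx => yz _; apply: IH => //.
  by apply: leq_trans dg; rewrite doubleS ltnS ltnW.
rewrite sum_nat_const expnS; congr (_ * _).
rewrite -(reg y) /degree (cardsD1 x) inE adj_sym xy /=.
by apply: eq_card => z; rewrite !inE andbC.
Qed.

Lemma arc_cyclesP d x y (t : g.-tuple G) : 0 < d -> g = d.*2.+1 ->
  t \in arc_cycles g x y ->
  exists s1 s2, [/\ tval t = [:: x, y & s1 ++ s2], size s1 = d, size s2 = d.-1,
    nbwalk [:: x, y & s1] & nbwalk (last y s1 :: rcons s2 x)].
Proof.
move=> d0 gd; rewrite inE => /andP[ut /prefixP[s ts]].
have szs : size s = d + d.-1.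
  have := size_tuple t; rewrite ts gd -addnn /= => -[].
  by rewrite -{2}(prednK d0) addnS => -[].
exists (take d s), (drop d s); rewrite cat_take_drop size_drop size_take szs addKn.
have [ws1 ws2] : nbwalk [:: x, y & take d s] /\
    nbwalk (last y (take d s) :: rcons (drop d s) x).
  by apply: ucycleb_nbwalks; rewrite cat_take_drop -[_ :: _]ts.
split=> //; case: ltnP => // dd; apply/eqP.
by rewrite eqn_leq dd leq_addr.
Qed.

(** The bijection sends a [g]-cycle [x, y, ...] to its vertex at position [d + 1],
one end of the edge opposite to [x].  That vertex is joined to [y] and to [x] by
complementary arcs of length [d], both determined by their ends; conversely, the
walk along the branch and a shortest way back to [x] have total length at most
[g], so they form a [g]-cycle. *)
Lemma card_branch_ball d x y : 0 < d -> g = d.*2.+1 -> adj x y ->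
  #|branch d x y :&: ball d x| = #|arc_cycles g x y|.
Proof.
move=> d0 gd xy; pose f (t : g.-tuple G) := last x (take d.+2 t).
have fE (t : g.-tuple G) s1 s2 :
    tval t = [:: x, y & s1 ++ s2] -> size s1 = d -> f t = last y s1.
  by rewrite /f => -> <- /=; rewrite take_size_cat.
have inj_f : {in arc_cycles g x y &, injective f}.
  move=> t u /(arc_cyclesP d0 gd)[s1 [s2 [tE sz1 sz2 ws1 ws2]]].
  case/(arc_cyclesP d0 gd)=> [r1 [r2 [uE rz1 rz2 wr1 wr2]]].
  rewrite (fE _ _ _ tE sz1) (fE _ _ _ uE rz1) => eq_last.
  have E1 : s1 = r1.
    apply: nbwalk_inj (nbwalk_behead ws1) (nbwalk_behead wr1) eq_last _.
    by rewrite sz1 rz1 addnn gd.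
  apply: val_inj; rewrite /= tE uE -E1; congr [:: _, _ & _ ++ _].
  apply: (@rcons_injl _ x); rewrite -E1 in wr2.
  apply: nbwalk_inj ws2 wr2 _ _; rewrite ?last_rcons //.
  by rewrite !size_rcons sz2 rz2 prednK // addnn gd.
rewrite -(card_in_imset inj_f); apply: eq_card => w.
apply/setIP/imsetP=> [[/branchP[s1 [ws1 s1w sz1]] /ball_nbwalk[q [wq qw szq]]]|].
  (* A common first step would leave two walks from y of lengths d and d - 1. *)
  have neq : ohead (y :: s1) != ohead q.
    case: q wq qw szq => // z q wq qw szq; apply/eqP=> -[yz].
    have eq_s : s1 = q.
      apply: (nbwalk_inj (nbwalk_behead ws1)).
      - by rewrite yz (nbwalk_behead wq).
      - by rewrite [LHS]s1w yz.
      - by rewrite sz1 gd ltnS -addnn leq_add2l ltnW.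
    by move: szq; rewrite /= -eq_s sz1 ltnn.
  have leg := nbwalk_catrev_closed ws1 wq isT neq (etrans s1w (esym qw)).
  have szqd : size q = d.
    apply/eqP; rewrite eqn_leq szq; move: leg.
    by rewrite gd /= sz1 addSn ltnS -addnn leq_add2l.
  case/lastP: q szqd wq qw neq {szq leg} => [|q w'].
    by move=> h; rewrite -h in d0.
  rewrite last_rcons => szqd wq w'w neq; subst w'.
  have uE : ucycleb (@adj G) (x :: (y :: s1) ++ rev q).
    apply: nbwalk_ucycleb ws1 wq s1w neq _.
    by rewrite -ltnS -addnS -(size_rcons q w) szqd /= sz1 gd addSn addnn.
  have szt : size (x :: (y :: s1) ++ rev q) == g.
    by rewrite /= size_cat size_rev sz1 gd !eqSS -addnS -(size_rcons q w) szqd addnn.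
  exists (Tuple szt); first by rewrite inE uE /= !eqxx prefix0s.
  by rewrite (fE (Tuple szt) s1 (rev q)).
case=> t /(arc_cyclesP d0 gd)[s1 [s2 [tE sz1 sz2 ws1 ws2]]].
rewrite (fE _ _ _ tE sz1) => ->; split; first by apply/branchP; exists s1.
rewrite ballC; apply/ballP; exists (rcons s2 x).
by rewrite last_rcons size_rcons sz2 prednK //; split=> //; case/andP: ws2.
Qed.

(** The [(k-1)^d] endpoints of the branch are split according to their membership
in [ball d x]. *)
Lemma card_ballD k d x y : regular G k -> 0 < d -> g = d.*2.+1 -> adj x y ->
  #|arc_cycles g x y| + #|ball d y :\: ball d x| = k.-1 ^ d.
Proof.
move=> reg d0 gd xy.
rewrite -(card_branch_ball d0 gd xy) (ballD_branch _ xy) cardsID.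
by rewrite (card_branch reg) // gd.
Qed.

(** A cycle of length [g] through the arc [xy] also runs through [yx]. *)
Lemma card_ballDC k d x y : regular G k -> 0 < d -> g = d.*2.+1 -> adj x y ->
  #|ball d y :\: ball d x| = #|ball d x :\: ball d y|.
Proof.
move=> reg d0 gd xy; apply: (@addnI #|arc_cycles g x y|).
by rewrite {2}card_arc_cyclesC !(card_ballD reg) // adj_sym.
Qed.

Lemma sum_card_ballD k d x : regular G k -> 0 < d -> g = d.*2.+1 ->
  (#|cycles_through g x|).*2 + \sum_(y | adj x y) #|ball d y :\: ball d x|
    = k * k.-1 ^ d.
Proof.
move=> reg d0 gd; have g2 : 2 < g by rewrite gd; case: d d0 {gd}.
rewrite -card_rooted_cycles // -sum_arc_cycles ?(ltnW g2) // -big_split /=.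
rewrite (eq_bigr (fun=> k.-1 ^ d)) => [|y xy]; last exact: card_ballD.
rewrite sum_nat_const; congr (_ * _).
by rewrite -(reg x) /degree cardsE.
Qed.

(** * Excess and twins *)

(** With [t] the maximal number of twins, attained at [v], some edge [zw] has
excess at least [t + 1], and the at least [k - 1 - t] other neighbours of [z]
that are not twins of [z] have positive excess. *)
Lemma regular_leq_excess k d e (v0 : G) : regular G k -> 0 < d -> g = d.*2.+1 ->
  (forall x, \sum_(y | adj x y) #|ball d y :\: ball d x| = e) ->
  0 < e -> k <= e.
Proof.
move=> reg d0 gd sum_e e0.
pose twins x := [set y | adj x y && (ball d y \subset ball d x)].
have [v _ v_max] := arg_maxnP (fun v => #|twins v|) (isT : xpredT v0).
(* The excess is symmetric, so inclusion of one ball in the other suffices. *)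
have ball_twin u : u \in twins v -> ball d u = ball d v.
  rewrite inE => /andP[vu uv]; apply/eqP; rewrite eqEsubset uv -setD_eq0.
  by rewrite -cards_eq0 -(card_ballDC reg) // cards_eq0 setD_eq0.
have [y vy /set0Pn[w]] : exists2 y, adj v y & ball d y :\: ball d v != set0.
  apply/exists_inP; apply: contraLR e0; rewrite -eqn0Ngt -(sum_e v).
  rewrite negb_exists_in => /forall_inP all0; rewrite sum_nat_eq0.
  by apply/forall_inP=> y /all0; rewrite negbK cards_eq0.
rewrite ballD_branch // => /setDP[/branchP[p [vyp pw sp]] nvw].
case/lastP: p sp vyp pw => [h|p w']; first by rewrite -h in d0.
rewrite size_rcons last_rcons => sp vyp ww; subst w'.
case/andP: vyp => /= /andP[_]; rewrite rcons_path; set z := last y p.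
case/andP=> yp zw _.
have vz : z \in ball d v.
  by apply/ballP; exists (y :: p); rewrite /= vy sp.
have sub_zw : v |: twins v \subset ball d z :\: ball d w.
  apply/subsetP=> u uK; have bu : ball d u = ball d v.
    by case/setU1P: uK => [->|/ball_twin].
  by rewrite inE ballC bu nvw ballC bu.
have := subset_leq_card sub_zw.
rewrite cardsU1 inE adj_irrefl /= add1n (card_ballDC reg) // 1?adj_sym // => lt_v.
rewrite -(sum_e z) (bigD1 w) //=.
(* Every neighbour of z has positive excess or is a twin; w itself is counted by
   the leading 1. *)
have deg_z : k <= 1 +
    (\sum_(i | adj z i && (i != w)) #|ball d i :\: ball d z| + #|twins z|).
  have -> : k = \sum_(i | adj z i) 1 by rewrite sum1_card -(reg z) /degree cardsE.
  rewrite (bigD1 w) //= leq_add2l.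
  have -> : #|twins z| = \sum_(i | adj z i) (ball d i \subset ball d z : nat).
    by rewrite -big_mkcondr sum1_card cardsE.
  rewrite [X in _ <= _ + X](bigD1 w) //= addnCA.
  apply: leq_trans (leq_addl _ _); rewrite -big_split /=.
  apply: leq_sum => i _; rewrite -setD_eq0 -cards_eq0.
  by case: #|_|.
apply: leq_trans deg_z _; rewrite addnCA [X in _ <= X]addnC leq_add2l add1n.
by apply: leq_trans lt_v; rewrite ltnS; apply: v_max.
Qed.
End Girth.
End Walks.

Theorem corollary1p4 (k g eps : nat) (hk : (3 <= k)%N) (hg : (3 <= g)%N)
    (heps0 : (0 < eps)%N) (heps : eps%:R <= (k%:R - 1) / 2 :> rat)
    (hodd : odd g) (n : nat) (hn : (0 < n)%N) (lambda : nat)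
    (hlambda : lambda%:R = k%:R * (k%:R - 1) ^+ (g %/ 2) / 2 - eps%:R :> rat) :
  ~ exists G : sgraph, vgr n k g lambda G.
Proof.
case=> G [cardG reg [_ girth_ge] cyc].
have k0 : (0 < k)%N by apply: leq_trans hk.
have gd : g = (g./2).*2.+1 by rewrite -{1}(odd_double_half g) hodd.
have d0 : (0 < g./2)%N by rewrite half_gt0 ltnW.
have two_eps : (eps.*2 <= k.-1)%N.
  rewrite -(ler_nat rat) -muln2 natrM -ler_pdivlMr //.
  by rewrite -subn1 natrB.
have two_lambda : (lambda.*2 + eps.*2 = k * k.-1 ^ g./2)%N.
  apply/eqP; rewrite -(eqr_nat rat) -doubleD -muln2 natrM natrD hlambda subrK.
  by rewrite divfK // natrM natrX -subn1 natrB // divn2.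
have [v0 _] : exists v0, v0 \in G by apply/card_gt0P; rewrite cardG.
have := @regular_leq_excess G g girth_ge k g./2 eps.*2 v0 reg d0 gd _ _.
rewrite double_gt0 => /(_ _ heps0) H.
have : (k <= eps.*2)%N.
  apply: H => x; apply: (@addnI lambda.*2); rewrite two_lambda -(cyc x).
  exact: sum_card_ballD.
by move/leq_trans/(_ two_eps); rewrite -ltnS prednK // ltnn.
Qed.
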